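(* Let $\mathbb K\in\{\mathbb R,\mathbb C\}$, let $X\subseteq\mathbb K^n$ be a closed set with $0\in X$, and let $f:\mathbb K^n\to\mathbb R$ be a $C^2$ function. Assume that $0$ is a local minimizer of $f$ on $X$. Then: (i) one has $\langle\nabla f(0),u\rangle\ge0$ for all $u\in T_0X$; (ii) for every $u\in T_0X\setminus\{0\}$ satisfying $\langle\nabla f(0),u\rangle=0$, one has $$\inf_{w\in T^2_{0,u}X}\Bigl(\langle u,\nabla^2f(0)u\rangle+\langle\nabla f(0),w\rangle\Bigr)\ge0.$$
   Context: $T_0X$ is the set of $v\in\mathbb K^n$ for which there are $x_k\in X\setminus\{0\}$ and real $t_k>0$ with $x_k\to0$ and $t_kx_k\to v$. $T^2_{0,u}X$ is the set of all $w\in\mathbb K^n$ for which there are positive real numbers $t_k\downarrow0$ and $w_k\in\mathbb K^n$ with $w_k\to w$ such that $t_ku+\frac12t_k^2w_k\in X$ for every $k$. $\nabla f(0)$ and $\nabla^2f(0)$ are the gradient and Hessian of $f$ at $0$. When $\mathbb K=\mathbb C$, $\mathbb K^n$ is identified with $\mathbb R^{2n}$, $f$ is $C^2$ in the real sense, and gradient, Hessian and $\langle\cdot,\cdot\rangle$ are the real Euclidean ones. The infimum over the empty set is $+\infty$. *)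

(* Defs.v *)
From HB Require Import structures.
From mathcomp Require Import all_boot all_order all_algebra.
From mathcomp Require Import complex.
From mathcomp Require Import all_classical all_reals all_analysis.

Set Implicit Arguments.
Unset Strict Implicit.
Unset Printing Implicit Defensive.

Import Order.TTheory GRing.Theory Num.Theory.
Import numFieldNormedType.Exports.

Local Open Scope classical_set_scope.
Local Open Scope ring_scope.

Variant scalars := RealScalars | ComplexScalars.

Definition field_of (R : realType) (K : scalars) : numFieldType :=
  match K with RealScalars => R | ComplexScalars => R[i] end.

Definition of_real (R : realType) (K : scalars) : R -> field_of R K :=
  match K with
  | RealScalars => fun t => t
  | ComplexScalars => fun t => Complex t 0
  end.

Notation "''K[' R , K ]_ n" := ('rV[field_of R K]_n)
  (at level 8, n at level 2, format "''K[' R ,  K ]_ n") : type_scope.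

Definition real_dim (K : scalars) (n : nat) : nat :=
  match K with RealScalars => n | ComplexScalars => (n + n)%N end.

(* K^n is identified with R^n, resp. R^(2n), a complex vector x + iy
   corresponding to (x, y). *)
Definition to_real (R : realType) (K : scalars) (n : nat) :
    'K[R, K]_n -> 'rV[R]_(real_dim K n) :=
  match K with
  | RealScalars => fun z => z
  | ComplexScalars => fun z : 'rV[R[i]]_n =>
      row_mx (\row_j complex.Re (z 0 j)) (\row_j complex.Im (z 0 j))
  end.

Definition from_real (R : realType) (K : scalars) (n : nat) :
    'rV[R]_(real_dim K n) -> 'K[R, K]_n :=
  match K with
  | RealScalars => fun x => x
  | ComplexScalars => fun x : 'rV[R]_(n + n) =>
      \row_j Complex (lsubmx x 0 j) (rsubmx x 0 j)
  end.

Section RealCalculus.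
Context {R : realType} {m : nat}.
Implicit Types (g : 'rV[R]_m -> R) (x y : 'rV[R]_m).

Definition dot x y : R := \sum_(i < m) x 0 i * y 0 i.

Definition grad g x : 'rV[R]_m := \row_i 'D_(delta_mx 0 i) g x.

Definition hess g x : 'M[R]_m :=
  \matrix_(i, j) 'D_(delta_mx 0 j) (fun y => grad g y 0 i) x.

(* 'D_v is a total operator, so differentiability has to be required
   separately at both orders. *)
Definition C2 g : Prop :=
  [/\ forall x, differentiable g x,
      forall x, differentiable (grad g) x
    & continuous (hess g)].

End RealCalculus.

Section KSpace.
Context {R : realType} {K : scalars} {n : nat}.
Implicit Types (f : 'K[R, K]_n -> R) (X : set 'K[R, K]_n) (u v w : 'K[R, K]_n).

Definition inner u v : R := dot (to_real u) (to_real v).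

Definition realC2 f : Prop := C2 (fun x => f (from_real x)).

Definition gradient f u : 'K[R, K]_n :=
  from_real (grad (fun x => f (from_real x)) (to_real u)).

(* Vectors are rows, hence the transpose. *)
Definition hessian f u v : 'K[R, K]_n :=
  from_real (to_real v *m (hess (fun x => f (from_real x)) (to_real u))^T).

Definition local_minimizer f X u : Prop :=
  X u /\ \forall v \near u, X v -> f u <= f v.

Definition tangent_cone X : set 'K[R, K]_n :=
  [set v | exists (x : nat -> 'K[R, K]_n) (t : nat -> R),
    [/\ forall k, (X `\ 0) (x k),
        forall k, 0 < t k,
        x k @[k --> \oo] --> (0 : 'K[R, K]_n)
      & of_real K (t k) *: x k @[k --> \oo] --> v]].

Definition second_tangent_set X u : set 'K[R, K]_n :=
  [set w | exists (t : nat -> R) (w_ : nat -> 'K[R, K]_n),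
    [/\ forall k, 0 < t k,
        t k @[k --> \oo] --> 0,
        w_ k @[k --> \oo] --> w
      & forall k, X (of_real K (t k) *: u
                     + of_real K (2^-1 * t k ^+ 2) *: w_ k)]].

End KSpace.

(* Main.v *)
(** Identify K^n with R^m.  If x_k -> 0 in X and t_k x_k -> u, the first order
    expansion of f at 0, multiplied by t_k, gives
    0 <= <grad f(0), t_k x_k> + o(1).
    If t_k u + t_k^2 w_k / 2 = t_k z_k lies in X with w_k -> w, then z_k -> u,
    and since <grad f(0), u> = 0 the second order Peano expansion, divided by
    t_k^2 / 2, gives 0 <= <z_k, Hess f(0) z_k> + <grad f(0), w_k> + o(1). *)

Require Import Defs.
From HB Require Import structures.
From mathcomp Require Import all_boot all_order all_algebra.
From mathcomp Require Import complex.
From mathcomp Require Import all_classical all_reals all_analysis.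
From mathcomp Require Import ring lra.

Set Implicit Arguments.
Unset Strict Implicit.
Unset Printing Implicit Defensive.

Import Order.TTheory GRing.Theory Num.Theory.
Import numFieldNormedType.Exports.

Local Open Scope classical_set_scope.
Local Open Scope ring_scope.

Section RealExpansions.
Context {R : realType} {m : nat}.
Implicit Types (x y h u v w : 'rV[R]_m) (g : 'rV[R]_m -> R).

(** * Algebra, bounds and continuity of the dot product *)

Lemma dotC x y : dot x y = dot y x.
Proof. by apply: eq_bigr => i _; rewrite mulrC. Qed.

Lemma dotDl x y v : dot (x + y) v = dot x v + dot y v.
Proof. by rewrite -big_split; apply: eq_bigr => i _; rewrite mxE mulrDl. Qed.

Lemma dotZl a x v : dot (a *: x) v = a * dot x v.
Proof. by rewrite mulr_sumr; apply: eq_bigr => i _; rewrite mxE mulrA. Qed.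

Lemma dotDr x y v : dot v (x + y) = dot v x + dot v y.
Proof. by rewrite dotC dotDl !(dotC v). Qed.

Lemma dotZr a x v : dot v (a *: x) = a * dot v x.
Proof. by rewrite dotC dotZl (dotC v). Qed.

Lemma dotBl x y v : dot (x - y) v = dot x v - dot y v.
Proof. by rewrite -scaleN1r dotDl dotZl mulN1r. Qed.

Lemma normr_coord_le x i : `|x 0 i| <= `|x|.
Proof.
rewrite {2}/Num.norm/= mx_normrE.
exact: (le_bigmax _ (fun ij => `|x ij.1 ij.2|) (0, i)).
Qed.

(** The norm on rows is the sup norm, so each of the [m] products of coordinates is at most the
    product of the norms; this replaces Cauchy-Schwarz at the cost of a factor [m]. *)
Lemma normr_dot_le x y : `|dot x y| <= m%:R * (`|x| * `|y|).
Proof.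
apply: le_trans (ler_norm_sum _ _ _) _.
rewrite -[m in m%:R]card_ord -sumr_const mulr_suml.
apply: ler_sum => i _; rewrite mul1r normrM.
by apply: ler_pM => //; apply: normr_coord_le.
Qed.

Lemma cvg_dot (T : Type) (F : set_system T) {FF : Filter F}
    (y z : T -> 'rV[R]_m) v w :
  y @ F --> v -> z @ F --> w -> dot (y k) (z k) @[k --> F] --> dot v w.
Proof.
move=> yv zw; apply: cvg_big => [|i _]; first exact: add_continuous.
apply: cvgM.
- exact: (cvg_comp y (fun x => x 0 i) yv (@coord_continuous _ _ _ 0 i _)).
- exact: (cvg_comp z (fun x => x 0 i) zw (@coord_continuous _ _ _ 0 i _)).
Qed.

(** * Differentials in coordinates and Peano expansions of order one and two *)

Lemma diff_dot_grad g x v : differentiable g x -> 'd g x v = dot (grad g x) v.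
Proof.
move=> dg; rewrite [in LHS](row_sum_delta v) linear_sum.
by apply: eq_bigr => i _; rewrite linearZ mxE deriveE// mulrC.
Qed.

Lemma diff_grad_hess g x v : differentiable (grad g) x ->
  'd (grad g) x v = v *m (hess g x)^T.
Proof.
move=> dg; rewrite [in LHS](row_sum_delta v) linear_sum.
apply/rowP => i; rewrite summxE mxE; apply: eq_bigr => j _.
rewrite linearZ !mxE -deriveE// derive_mx ?mxE//.
exact: diff_derivable.
Qed.

Lemma first_order_expansion (V W : normedModType R) (f : V -> W) (x : V) :
  differentiable f x -> forall e, 0 < e ->
  \forall h \near 0, `|f (h + x) - f x - 'd f x h| <= e * `|h|.
Proof.
move=> /diff_locally/eqaddoP df e /df; apply: filterS => h /=.
by rewrite !fctE opprD addrA.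
Qed.

Lemma is_derive_line g x h (s : R) : differentiable g (s *: h + x) ->
  is_derive s 1 (fun s => g (s *: h + x)) (dot (grad g (s *: h + x)) h).
Proof.
move=> dg.
have dl : is_diff s (fun s => s *: h + x) (fun s => s *: h).
  by have := is_diffD (is_diff_scalel s h) (is_diff_cst x s); rewrite addr0.
have dgl : differentiable (g \o (fun s => s *: h + x)) s.
  by apply: differentiable_comp.
apply: DeriveDef; first exact: (diff_derivable dgl).
rewrite (deriveE _ dgl).
rewrite diff_comp//= diff_val scale1r.
exact: diff_dot_grad.
Qed.

(** Since [grad g] is only assumed differentiable at [x], the remainder has Peano form. The mean
    value theorem on the segment from [x] to [h + x] turns it into the first order remainder of
    [grad g] at some [c *: h], paired with [h]. *)
Lemma second_order_expansion g x :
  (forall y, differentiable g y) -> differentiable (grad g) x ->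
  forall e, 0 < e -> \forall h \near (0 : 'rV[R]_m),
    `|g (h + x) - g x - dot (grad g x) h - 2^-1 * dot h (h *m (hess g x)^T)|
      <= e * `|h| ^+ 2.
Proof.
move=> dg dgrad e e0.
(* Dividing by [m.+1] absorbs the factor [m] of [normr_dot_le] and stays meaningful for [m = 0]. *)
have e'0 : 0 < e / m.+1%:R by rewrite divr_gt0.
have /nbhs_ballP[d /= d0 gradP] := first_order_expansion dgrad e'0.
apply/nbhs_ballP; exists d => //= h; rewrite mx_norm_ball/= /ball_.
rewrite sub0r normrN => hd.
set q := dot h _; set p := dot _ h.
(* Subtracting the quadratic model along the segment makes [phi 1 - phi 0] exactly the remainder to
   be bounded. *)
pose phi s := g (s *: h + x) - (p * s + 2^-1 * q * (s * s)).
pose dphi s := dot (grad g (s *: h + x)) h - (p + q * s).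
have dphiP (s : R) : is_derive s 1 phi (dphi s).
  apply: is_deriveB; first exact: is_derive_line.
  have sid := is_derive_id s (1 : R).
  apply: is_derive_eq (is_deriveD (is_deriveZ p sid)
    (is_deriveZ (2^-1 * q) (is_deriveM sid sid))) _.
  by rewrite /GRing.scale/=; field.
have [c] : exists2 c, c \in `[0, 1]%R & phi 1 - phi 0 = dphi c * (1 - 0).
  apply: MVT_segment => //.
  by apply: derivable_within_continuous => s _; exact: ex_derive.
rewrite in_itv/= => /andP[c0 c1].
rewrite /phi !scale1r scale0r add0r => phiE.
have ch : `|c *: h| <= `|h| by rewrite normrZ ger0_norm// ler_piMl.
have -> : g (h + x) - g x - p - 2^-1 * q = dphi c by move: phiE; lra.
(* By linearity of the differential, [p + q * c] is the pairing of [h] with the first order model of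
   [grad g] at [c *: h]. *)
have -> : dphi c =
    dot (grad g (c *: h + x) - grad g x - 'd (grad g) x (c *: h)) h.
  by rewrite diff_grad_hess// -scalemxAl !dotBl dotZl [dot (h *m _) h]dotC
    -/p -/q /dphi; ring.
apply: le_trans (normr_dot_le _ _) _.
have /gradP gradP' : ball (0 : 'rV[R]_m) d (c *: h).
  by rewrite mx_norm_ball/= /ball_ sub0r normrN (le_lt_trans ch).
apply: (@le_trans _ _ (m.+1%:R * (e / m.+1%:R * `|h| * `|h|))).
  apply: ler_pM => //; first by rewrite ler_nat.
  apply: ler_pM => //; apply: (le_trans gradP').
  by rewrite ler_wpM2l// ltW.
by rewrite le_eqVlt; apply/orP; left; apply/eqP; field.
Qed.

(** * Necessary conditions along sequences in a real space *)

Lemma first_order_condition g x (v : 'rV[R]_m) (y : nat -> 'rV[R]_m)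
    (t : nat -> R) :
  differentiable g x -> (forall k, 0 < t k) -> y @ \oo --> (0 : 'rV[R]_m) ->
  t k *: y k @[k --> \oo] --> v ->
  (\forall k \near \oo, g x <= g (y k + x)) -> 0 <= dot (grad g x) v.
Proof.
move=> dg t0 y0 yv gmin; apply/ler_addgt0Pr => e e0.
(* With this tolerance the error in the limit is a multiple of [|v| / (|v| + 1)], hence at most [e];
   the [+ 1] covers [v = 0]. *)
have e'0 : 0 < e / (`|v| + 1) by rewrite divr_gt0// ltr_wpDl.
have : 0 <= dot (grad g x) v + e / (`|v| + 1) * `|v|.
  have : dot (grad g x) (t k *: y k) + e / (`|v| + 1) * `|t k *: y k|
      @[k --> \oo] --> dot (grad g x) v + e / (`|v| + 1) * `|v|.
    apply: cvgD; first by apply: cvg_dot yv; exact: cvg_cst.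
    by apply: cvgM; [exact: cvg_cst | exact: cvg_norm].
  move=> /cvgr_to_ge; apply.
  have := y0 _ (first_order_expansion dg e'0); rewrite nbhs_simpl/= => expg.
  near=> k.
  (* The factor [t k > 0] comes out of both terms, leaving an inequality on [y k] given by
     minimality and the expansion. *)
  rewrite dotZr normrZ (gtr0_norm (t0 k)) mulrCA -mulrDr.
  rewrite mulr_ge0 ?(ltW (t0 k))//.
  have gk : g x <= g (y k + x) by near: k.
  have : `|g (y k + x) - g x - 'd g x (y k)| <= e / (`|v| + 1) * `|y k|.
    by near: k.
  rewrite diff_dot_grad// ler_norml; set a := _ / _ * _.
  by move=> /andP[_]; lra.
move=> /le_trans; apply; rewrite lerD2l mulrAC ler_pdivrMr ?ltr_wpDl//.
by rewrite ler_pM2l// lerDl.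
Unshelve. all: by end_near. Qed.

Lemma second_order_condition g x (u w : 'rV[R]_m) (w_ : nat -> 'rV[R]_m)
    (t : nat -> R) :
  (forall y, differentiable g y) -> differentiable (grad g) x ->
  dot (grad g x) u = 0 -> (forall k, 0 < t k) -> t @ \oo --> 0 ->
  w_ @ \oo --> w ->
  (\forall k \near \oo, g x <= g (t k *: u + (2^-1 * t k ^+ 2) *: w_ k + x)) ->
  0 <= dot u (u *m (hess g x)^T) + dot (grad g x) w.
Proof.
move=> dg dgrad gu0 t0 t_0 w_w gmin; apply/ler_addgt0Pr => e e0.
pose z k := u + (2^-1 * t k) *: w_ k.
have zu : z @ \oo --> u.
  rewrite -[X in _ --> X]addr0 -[X in _ + X](scale0r w).
  rewrite -[X in X *: w](mulr0 2^-1).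
  apply: cvgD; first exact: cvg_cst.
  by apply: cvgZ => //; apply: cvgM => //; exact: cvg_cst.
have tz0 : t k *: z k @[k --> \oo] --> (0 : 'rV[R]_m).
  by rewrite -[X in _ --> X](scale0r u); exact: cvgZ.
set c := `|u| ^+ 2 + 1.
have c0 : 0 < c by rewrite ltr_wpDl.
(* The 2 anticipates the division by [t k ^+ 2 / 2]; the choice of [c] then keeps the error in the
   limit below [e]. *)
have e'0 : 0 < e / c / 2 by rewrite !divr_gt0.
have : 0 <=
    dot u (u *m (hess g x)^T) + dot (grad g x) w + e / c * (`|u| * `|u|).
  (* The quadratic term is written with the differential of [grad g], whose continuity gives its
     limit. *)
  have : dot (z k) ('d (grad g) x (z k)) + dot (grad g x) (w_ k)
      + e / c * (`|z k| * `|z k|) @[k --> \oo] -->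
      dot u ('d (grad g) x u) + dot (grad g x) w + e / c * (`|u| * `|u|).
    apply: cvgD.
      apply: cvgD.
        apply: cvg_dot => //.
        have dc := @diff_continuous _ _ _ _ _ dgrad.
        exact: (cvg_comp z ('d (grad g) x) zu (dc u)).
      by apply: cvg_dot => //; exact: cvg_cst.
    by apply: cvgM; [exact: cvg_cst | apply: cvgM; exact: cvg_norm].
  rewrite diff_grad_hess// => /cvgr_to_ge; apply.
  have := tz0 _ (second_order_expansion dg dgrad e'0).
  rewrite nbhs_simpl/= => expg.
  near=> k.
  have gk : g x <= g (t k *: u + (2^-1 * t k ^+ 2) *: w_ k + x) by near: k.
  have : `|g (t k *: z k + x) - g x - dot (grad g x) (t k *: z k)
         - 2^-1 * dot (t k *: z k) (t k *: z k *m (hess g x)^T)|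
       <= e / c / 2 * `|t k *: z k| ^+ 2 by near: k.
  have tzE : t k *: z k = t k *: u + (2^-1 * t k ^+ 2) *: w_ k.
    by rewrite scalerDr scalerA; congr (_ + _ *: _); ring.
  rewrite diff_grad_hess// ler_norml => /andP[_].
  (* Only the value of [g] and the linear term are expanded: there [gu0] removes the order [t k]
     part. The quadratic term and the error keep the form [t k *: z k], from which [t k ^+ 2]
     factors out. *)
  rewrite {1 2}tzE dotDr !dotZr gu0 mulr0 add0r.
  rewrite -scalemxAl dotZl dotZr normrZ (gtr0_norm (t0 k)).
  set q := dot (z k) _; set p := dot _ (w_ k); set r := `|z k|.
  move=> gq.
  rewrite -(pmulr_rge0 _ (_ : 0 < t k ^+ 2 / 2)) ?divr_gt0 ?exprn_gt0//.
  nra.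
move=> /le_trans; apply; rewrite lerD2l mulrAC ler_pdivrMr//.
by rewrite ler_pM2l// -expr2 lerDl.
Unshelve. all: by end_near. Qed.

End RealExpansions.

(** * The identification of K^n with a real space, and its continuity *)

Section Realification.
Context {R : realType} {K : scalars} {n : nat}.
Implicit Types (x z : 'K[R, K]_n).

Lemma to_realK : cancel (@to_real R K n) (@from_real R K n).
Proof.
case: K => //= z; apply/rowP => j; rewrite mxE row_mxKl row_mxKr !mxE.
by case: (z 0 j).
Qed.

Lemma from_realK : cancel (@from_real R K n) (@to_real R K n).
Proof.
case: K => //= x; rewrite -[RHS]hsubmxK.
by congr row_mx; apply/rowP => j; rewrite !mxE.
Qed.

Lemma to_realD x z : to_real (x + z) = to_real x + to_real z.
Proof.
case: K x z => //= x z; rewrite add_row_mx.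
by congr row_mx; apply/rowP => j; rewrite !mxE; case: (x 0 j) (z 0 j) => ? ? [].
Qed.

Lemma to_realZ (a : R) x : to_real (of_real K a *: x) = a *: to_real x.
Proof.
case: K x => //= x; rewrite scale_row_mx.
by congr row_mx; apply/rowP => j; rewrite !mxE; case: (x 0 j) => b c /=; ring.
Qed.

Lemma of_real0 : of_real K (0 : R) = 0.
Proof. by case: K. Qed.

Lemma to_real0 : to_real (0 : 'K[R, K]_n) = 0.
Proof.
by rewrite -(scale0r (0 : 'K[R, K]_n)) -of_real0 to_realZ scale0r.
Qed.

Lemma to_real_continuous : continuous (@to_real R K n).
Proof.
case: K => [z | z A]; first exact: cvg_id.
move=> /(@nbhs_ballP R _ (to_real z))[e /= e0 eA].
apply/(@nbhs_ballP (field_of R ComplexScalars) _ z).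
(* Balls of the complex space have radii in [R[i]], so the real radius [e] is embedded there. *)
exists (Complex e 0); first by rewrite /= ltcR.
move=> y [_ zy]; apply: eA; split=> // i j.
have Re_lt_e (a b : R[i]) :
    `|a - b| < (e%:C)%C -> `|complex.Re a - complex.Re b| < e.
  move=> ab; rewrite -raddfB -ltcR; exact: le_lt_trans (normc_ge_Re _) ab.
(* Multiplication by ['i] preserves the modulus and turns the imaginary part into minus a real part,
   which reduces this to [Re_lt_e]. *)
have Im_lt_e (a b : R[i]) :
    `|a - b| < (e%:C)%C -> `|complex.Im a - complex.Im b| < e.
  move=> ab; rewrite -normrN opprD -!ReiNIm; apply: Re_lt_e.
  have norm_i : `|'i%C : R[i]| = 1.
    by rewrite normc_def /= expr0n add0r expr1n sqrtr1.
  by rewrite -mulrBl normrM norm_i mulr1.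
have {}zy k : `|z 0 k - y 0 k| < (e%:C)%C by exact: zy.
case: (split_ordP j) => k ->;
  rewrite ord1 (row_mxEl, row_mxEr) (row_mxEl, row_mxEr) !mxE.
- exact: Re_lt_e.
- exact: Im_lt_e.
Qed.

Lemma of_real_continuous : continuous (@of_real R K).
Proof.
case: K => [a | a A]; first exact: cvg_id.
move=> /(@nbhs_ballP (field_of R ComplexScalars) _ (of_real ComplexScalars a)).
case=> -[e e'] /=.
(* Positivity in [R[i]] forces a zero imaginary part, so the complex radius is a real one. *)
rewrite ltcE/= => /andP[/eqP-> e0] eA; apply/nbhs_ballP; exists e => // b ab.
apply: eA; rewrite /ball/= /ball_ /= normc_def/= subrr expr0n addr0.
rewrite sqrtr_sqr ltcR.
exact: ab.
Qed.

End Realification.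

(** * Transfer of the two conditions to K^n *)

Theorem theorem5p1 (R : realType) (K : scalars) (n : nat)
    (X : set 'K[R, K]_n) (f : 'K[R, K]_n -> R)
    (X_closed : closed X) (X0 : X 0) (f_C2 : realC2 f)
    (f_min : local_minimizer f X 0) :
  (forall u, tangent_cone X u -> 0 <= inner (gradient f 0) u) /\
  (forall u, (tangent_cone X `\ 0) u -> inner (gradient f 0) u = 0 ->
     (0 <= ereal_inf [set (inner u (hessian f 0 u)
                           + inner (gradient f 0) w)%:E
                     | w in second_tangent_set X u])%E).
Proof.
have [dg dgrad _] := f_C2; have [_ fmin] := f_min.
(* After cancellation, the inner products with the gradient are dot products with the real gradient
   of [f] composed with [from_real], at the origin. *)
rewrite /inner /gradient /hessian !from_realK to_real0.
split=> [u [x [t [xX t0 x0 xu]]] | u _ gu0].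
  apply: (@first_order_condition _ _ _ _ _ (fun k => to_real (x k)) t) => //.
  - rewrite -[X in _ --> X](@to_real0 R K n).
    exact: (cvg_comp x _ x0 (@to_real_continuous _ _ _ _)).
  - have := cvg_comp _ _ xu (@to_real_continuous _ _ _ _).
    rewrite (_ : _ \o _ = fun k => t k *: to_real (x k))//.
    by apply/funext => k; exact: to_realZ.
  - have := x0 _ fmin; rewrite nbhs_simpl/=; apply: filterS => k /(_ (xX k).1).
    by rewrite addr0 to_realK -(to_realK 0) to_real0.
(* Bounding the infimum below means bounding every element, which also settles an empty second order
   tangent set. *)
apply/ereal_infP => _ [w [t [w_ [t0 t_0 w_w xX]]] <-].
rewrite lee_fin from_realK.
apply: (@second_order_condition _ _ _ _ _ _ (fun k => to_real (w_ k)) t) => //.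
- exact: (cvg_comp w_ _ w_w (@to_real_continuous _ _ _ _)).
pose x k := of_real K (t k) *: u + of_real K (2^-1 * t k ^+ 2) *: w_ k.
have xE k :
    to_real (x k) = t k *: to_real u + (2^-1 * t k ^+ 2) *: to_real (w_ k).
  by rewrite to_realD !to_realZ.
have x0 : x @ \oo --> (0 : 'K[R, K]_n).
  have cvg_of_real (a : nat -> R) l : a @ \oo --> l ->
      of_real K (a k) @[k --> \oo] --> of_real K l.
    by move=> al; exact: (cvg_comp a _ al (@of_real_continuous _ _ _)).
  (* Both scalar coefficients tend to 0 while [w_ k] tends to [w], so the limit is displayed in the
     same shape as [x k]. *)
  have -> : (0 : 'K[R, K]_n) = of_real K 0 *: u + of_real K 0 *: w.
    by rewrite of_real0 !scale0r addr0.
  apply: cvgD; apply: cvgZ => //; try exact: cvg_cst;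
    apply: cvg_of_real => //.
  rewrite -[X in _ --> X](mulr0 2^-1) -[X in _ * X](mulr0 0).
  by apply: cvgM; [exact: cvg_cst | exact: cvgM].
have := x0 _ fmin; rewrite nbhs_simpl/=; apply: filterS => k /(_ (xX k)).
by rewrite addr0 -xE to_realK -(to_realK 0) to_real0.
Qed.
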